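(* Let $(R,\mathfrak{m})$ be an Arf local domain. Suppose that the integral closure $\overline{R}$ of $R$ is a local ring and is finitely generated as an $R$-module. Then there are only finitely many indecomposable reflexive $R$-modules up to isomorphism.
   Context: All rings are commutative and Noetherian, and all modules are finitely generated. $\mathrm{Q}(R)$ denotes the total ring of fractions of $R$ and $\overline{R}$ the integral closure of $R$ in $\mathrm{Q}(R)$. For an ideal $I$, $\overline{I}$ denotes the integral closure of $I$ in $R$; $I$ is integrally closed if $I=\overline{I}$. Arf ring: let $R$ be a Cohen-Macaulay semi-local ring with $\dim R_{\mathfrak{n}}=1$ for all maximal ideals $\mathfrak{n}$. $R$ is an Arf ring if (1) for every integrally closed ideal $I$ containing a non-zerodivisor of $R$ there exists $a\in I$ such that $I=\overline{(a)}$, i.e. $I^{n+1}=aI^n$ for some $n\ge 0$; and (2) if $x,y,z\in R$ are such that $x$ is a non-zerodivisor of $R$ and $\frac{y}{x},\frac{z}{x}\in\overline{R}$, then $\frac{yz}{x}\in R$. (By a theorem of Lipman, this is equivalent to: for every integrally closed ideal $I$ containing a non-zerodivisor of $R$ there exists $a\in I$ with $I^2=aI$.) An Arf local domain is an Arf ring that is a local integral domain. Reflexive: write $M^*=\operatorname{Hom}_R(M,R)$. An $R$-module $M$ is reflexive if the canonical map $M\to M^{**}$, $x\mapsto (f\mapsto f(x))$, is bijective. *)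

(* Defs.v *)
From HB Require Import structures.
From mathcomp Require Import all_boot all_order all_algebra.
From mathcomp Require Import boolp classical_sets functions.

Set Implicit Arguments.
Unset Strict Implicit.
Unset Printing Implicit Defensive.

Import GRing.Theory.
Local Open Scope classical_set_scope.
Local Open Scope ring_scope.

Section Ideals.
Variable R : comNzRingType.
Implicit Types (I J P m : set R) (s : seq R).

(* The unit ideal is allowed here, whereas [idealr_closed] means proper ideal. *)
Definition is_ideal I : Prop := submod_closed ([in I] : {pred R^o}).

Definition prime_ideal P : Prop :=
  idealr_closed [in P] /\ prime_idealr_closed [in P].

Definition maximal_ideal m : Prop :=
  idealr_closed [in m] /\ forall J, idealr_closed [in J] -> m `<=` J -> J = m.

Definition local_ring m : Prop :=
  maximal_ideal m /\ forall n : set R, maximal_ideal n -> n = m.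

Definition gen_ideal s : set R :=
  [set x | exists c : nat -> R, x = \sum_(i < size s) c i * s`_i].

Definition noetherian : Prop :=
  forall I, is_ideal I -> exists s, I = gen_ideal s.

Definition ideal_mul I J : set R :=
  [set x | exists s : seq (R * R),
     (forall p, p \in s -> I p.1 /\ J p.2) /\ x = \sum_(p <- s) p.1 * p.2].

Definition ideal_pow I (n : nat) : set R := iter n (ideal_mul I) setT.

(* The r with r^n + a_1 r^(n-1) + ... + a_n = 0, where n > 0 and a_i in I^i. *)
Definition ideal_closure I : set R :=
  [set r | exists (n : nat) (a : nat -> R),
     [/\ (0 < n)%N,
         forall i, (1 <= i <= n)%N -> ideal_pow I i (a i)
       & r ^+ n + \sum_(1 <= i < n.+1) a i * r ^+ (n - i) = 0]].

Definition integrally_closed_ideal I : Prop :=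
  is_ideal I /\ I = ideal_closure I.

Definition prime_chain (d : nat) (p : nat -> set R) : Prop :=
  (forall i, (i <= d)%N -> prime_ideal (p i)) /\
  (forall i, (i < d)%N -> p i `<` p i.+1).

Definition krull_dim_eq (d : nat) : Prop :=
  (exists p, prime_chain d p) /\ forall e p, prime_chain e p -> (e <= d)%N.

Definition regular_sequence s : Prop :=
  (forall i r, (i < size s)%N ->
     gen_ideal (take i s) (s`_i * r) -> gen_ideal (take i s) r) /\
  ~ gen_ideal s 1.

Definition depth_eq m (d : nat) : Prop :=
  (exists s, [/\ [set` s] `<=` m, regular_sequence s & size s = d]) /\
  forall s, [set` s] `<=` m -> regular_sequence s -> (size s <= d)%N.

(* Meant for a local ring with maximal ideal [m]. *)
Definition cohen_macaulay m : Prop :=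
  exists d, krull_dim_eq d /\ depth_eq m d.

End Ideals.

Section IntegralClosure.
Variable R : idomainType.

Definition integral_frac : {pred {fraction R}} :=
  [pred u | `[< integralOver (@tofrac R) u >]].

Fact integral_frac_subring : subring_closed integral_frac.
Proof.
split; first by apply/asboolP; exact: integral1.
- by move=> u v /asboolP hu /asboolP hv; apply/asboolP; exact: integral_sub.
- by move=> u v /asboolP hu /asboolP hv; apply/asboolP; exact: integral_mul.
Qed.

HB.instance Definition _ :=
  GRing.isSubringClosed.Build {fraction R} integral_frac integral_frac_subring.

(* For a domain the total ring of fractions is [{fraction R}]. *)
Definition int_closure : Type := {u : {fraction R} | u \in integral_frac}.
HB.instance Definition _ := [isSub of int_closure for @sval _ _].
HB.instance Definition _ := [Choice of int_closure by <:].
HB.instance Definition _ := [SubChoice_isSubComNzRing of int_closure by <:].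

Fact tofrac_integral (a : R) : tofrac a \in integral_frac.
Proof. by apply/asboolP; exact: integral_id. Qed.

Definition to_int_closure (a : R) : int_closure :=
  exist _ (tofrac a) (tofrac_integral a).

Definition int_closure_scale (a : R) (u : int_closure) : int_closure :=
  to_int_closure a * u.

Fact int_closure_scaleA a b u :
  int_closure_scale a (int_closure_scale b u) = int_closure_scale (a * b) u.
Proof.
rewrite /int_closure_scale mulrA; congr (_ * u).
by apply: val_inj; rewrite /= tofracM.
Qed.

Fact int_closure_scale1 : left_id 1 int_closure_scale.
Proof.
move=> u; rewrite /int_closure_scale -[RHS]mul1r; congr (_ * u).
by apply: val_inj; rewrite /= tofrac1.
Qed.

Fact int_closure_scaleDr : right_distributive int_closure_scale +%R.
Proof. by move=> a u v; rewrite /int_closure_scale mulrDr. Qed.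

Fact int_closure_scaleDl u : {morph int_closure_scale^~ u : a b / a + b}.
Proof.
move=> a b; rewrite /int_closure_scale -mulrDl; congr (_ * u).
by apply: val_inj; rewrite /= tofracD.
Qed.

HB.instance Definition _ := GRing.Zmodule_isLmodule.Build R int_closure
  int_closure_scaleA int_closure_scale1 int_closure_scaleDr int_closure_scaleDl.

End IntegralClosure.

Section Modules.
Variable R : comNzRingType.
Implicit Types M N : lmodType R.

Definition finitely_generated M : Prop :=
  exists (n : nat) (g : 'I_n -> M),
    forall x, exists c : 'I_n -> R, x = \sum_i c i *: g i.

Definition mod_iso M N : Prop := exists f : {linear M -> N}, bijective f.

Definition zero_module M : Prop := forall x : M, x = 0.

Definition indecomposable M : Prop :=
  ~ zero_module M /\
  forall A B : lmodType R,
    mod_iso M (A * B)%type -> zero_module A \/ zero_module B.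

End Modules.

Section Dual.
Variables (R : comNzRingType) (M : lmodType R).

Definition linear_fun : {pred M -> R^o} :=
  [pred f : M -> R^o | `[< linear f >]].

Fact linear_fun_submod : submod_closed linear_fun.
Proof.
split; first by apply/asboolP => a u v /=; rewrite scaler0 addr0.
move=> b f g /asboolP lf /asboolP lg; apply/asboolP => a u v.
have E (w : M) : (b *: f + g) w = b *: f w + g w by [].
rewrite !E lf lg !scalerDr !scalerA (mulrC a b).
by rewrite -!addrA; congr (_ + _); rewrite addrCA.
Qed.

HB.instance Definition _ :=
  GRing.isSubmodClosed.Build R (M -> R^o) linear_fun linear_fun_submod.

(* M^* = Hom_R(M, R), as a submodule of the module of all functions M -> R. *)
Definition dual : Type := {f : M -> R^o | f \in linear_fun}.
HB.instance Definition _ := [isSub of dual for @sval _ _].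
HB.instance Definition _ := [Choice of dual by <:].
HB.instance Definition _ := [SubChoice_isSubLmodule of dual by <:].

End Dual.

Section Reflexive.
Variables (R : comNzRingType) (M : lmodType R).

Fact eval_linear (x : M) :
  (fun f : dual M => val f x) \in @linear_fun R (dual M).
Proof. by apply/asboolP => a f g; rewrite linearP. Qed.

Definition eval_map (x : M) : dual (dual M) :=
  exist _ (fun f : dual M => val f x) (eval_linear x).

Definition reflexive_module : Prop := bijective eval_map.

End Reflexive.

(* A local ring is its own localization at its unique maximal ideal, so the
   semi-local conditions on Cohen-Macaulayness and dimension are conditions on
   R itself. *)
Definition arf_local_domain (R : idomainType) (m : set R) : Prop :=
  [/\ [/\ noetherian R, local_ring m, cohen_macaulay m & krull_dim_eq R 1],
      forall I : set R, integrally_closed_ideal I ->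
        (exists2 x, I x & GRing.lreg x) ->
        exists2 a, I a & I = ideal_closure (gen_ideal [:: a])
    & forall x y z : R, GRing.lreg x ->
        integralOver (@tofrac R) (tofrac y / tofrac x) ->
        integralOver (@tofrac R) (tofrac z / tofrac x) ->
        exists r : R, tofrac r = tofrac (y * z) / tofrac x].

(* Main.v *)
(* Let V be the integral closure of R and n its maximal ideal. For z != 0 put
   A_z = zV \cap R. The second Arf condition makes A_z / z a ring. Let M be
   reflexive and suppose every f : M -> R has its image in A_z; by reflexivity
   M is then a module over A_z / z. If some f takes a value z u with u not in
   n, then z / u lies in R, so some e in M has f e = z and y |-> (y / z) e
   splits f : M -> A_z; an indecomposable M is thus isomorphic to A_z.
   Otherwise all images lie in zn \cap R, an integrally closed ideal, which by
   the first Arf condition is the integral closure of some (z'), so it lies in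
   A_z' and the argument repeats. Starting from z_0 = 1 this gives z_{i+1} in
   z_i n. Since dV is contained in R for some d != 0, R being Noetherian forces
   the z_i V to have zero intersection, hence M = 0 if the process never stops,
   and forces the rings A_{z_i} / z_i to stabilise, leaving finitely many
   isomorphism classes. It is not necessary to know which A_{z_i} are reflexive
   or indecomposable. *)
From HB Require Import structures.
Require Import Defs.
From mathcomp Require Import all_boot all_order all_algebra generic_quotient.
From mathcomp Require Import boolp classical_sets functions.

Set Implicit Arguments.
Unset Strict Implicit.
Unset Printing Implicit Defensive.

Import GRing.Theory.
Local Open Scope classical_set_scope.
Local Open Scope quotient_scope.
Local Open Scope ring_scope.

(** * Submodules as modules, isomorphisms, and splitting off a retract *)

Section Submodule.
Variables (R : comNzRingType) (M : lmodType R) (S : submodClosed M).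

Definition submodule : Type := {x : M | x \in S}.
HB.instance Definition _ := [isSub of submodule for @sval _ _].
HB.instance Definition _ := [Choice of submodule by <:].
HB.instance Definition _ := [SubChoice_isSubLmodule of submodule by <:].

End Submodule.

Section Isomorphism.
Variable R : comNzRingType.
Implicit Types M N P : lmodType R.

Lemma mod_iso_sym M N : mod_iso M N -> mod_iso N M.
Proof.
move=> [f [g fK gK]].
pose gL := GRing.isLinear.Build R N M *:%R g (can2_linear fK gK).
pose G : {linear N -> M} := HB.pack g gL.
by exists G; exists f.
Qed.

Lemma mod_iso_trans N M P : mod_iso M N -> mod_iso N P -> mod_iso M P.
Proof.
move=> [f fB] [g gB]; pose h : {linear M -> P} := g \o f.
by exists h; exact: bij_comp.
Qed.

(** The candidates [C i] need not be [good]: one that is isomorphic to a good module is replaced by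
    such a module, any other by an arbitrary good [M0]. *)
Lemma finite_representatives n (C : 'I_n -> lmodType R)
    (good : lmodType R -> Prop) :
  (forall M, good M -> exists i, mod_iso M (C i)) ->
  exists (k : nat) (L : 'I_k -> lmodType R),
    (forall i, good (L i)) /\
    (forall M, good M -> exists i, mod_iso M (L i)).
Proof.
move=> goodC; have [[M0 M0P]|no_good] := pselect (exists M, good M); last first.
  exists 0%N, (fun=> (R^o : lmodType R)).
  by split=> [[]|M ?] //; case: no_good; exists M.
have /choice[L LP] (i : 'I_n) : exists L, good L /\
    ((exists2 M, good M & mod_iso M (C i)) -> mod_iso L (C i)).
  have [[M ? ?]|noM] := pselect (exists2 M, good M & mod_iso M (C i)).
    exists M; split=> //.
  exists M0; split=> [//|Mi]; last by case: noM.
exists n, L; split=> [i|M gM]; first exact: (LP i).1.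
have [i Mi] := goodC M gM; exists i; apply: mod_iso_trans (Mi) _.
by apply: mod_iso_sym; apply: (LP i).2; exists M.
Qed.

End Isomorphism.

Section Retract.
Variables (R : comNzRingType) (M N : lmodType R).
Variables (f : {linear M -> N}).

Definition linear_ker : {pred M} := [pred x | f x == 0].

Fact linear_ker_submod : submod_closed linear_ker.
Proof.
split=> [|a x y]; first by rewrite !inE raddf0.
by rewrite !inE linearP => /eqP-> /eqP->; rewrite scaler0 addr0.
Qed.

HB.instance Definition _ :=
  GRing.isSubmodClosed.Build R M linear_ker linear_ker_submod.

(** The section [g] splits [M] as [N] plus the kernel of [f], and indecomposability kills the kernel
    because [N] is nonzero. *)
Lemma indecomposable_retract (g : {linear N -> M}) :
  indecomposable M -> ~ zero_module N -> cancel g f -> mod_iso M N.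
Proof.
move=> [_ indecM] N_neq0 gK.
have projP x : x - g (f x) \in linear_ker by rewrite inE raddfB /= gK subrr.
pose proj x : submodule linear_ker := exist _ (x - g (f x)) (projP x).
pose h x : N * submodule linear_ker := (f x, proj x).
have h_lin : linear h.
  move=> a x y; congr (_, _); rewrite ?linearP //; apply: val_inj => /=.
  have -> : g (f (a *: x + y)) = a *: g (f x) + g (f y) by rewrite !linearP.
  by rewrite scalerBr opprD addrACA.
have h_bij : bijective h.
  exists (fun p => g p.1 + val p.2) => [x|[y [z zP]]] /=.
    by rewrite addrC subrK.
  have fz : f z = 0 by apply/eqP.
  have fyz : f (g y + z) = y by rewrite raddfD /= gK fz addr0.
  by congr (_, _) => //; apply: val_inj; rewrite /= fyz addrC addKr.
pose hL := GRing.isLinear.Build R _ _ _ h h_lin.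
pose H : {linear M -> (N * submodule linear_ker)%type} := HB.pack h hL.
have [//|ker0] := indecM N (submodule linear_ker) (ex_intro _ H h_bij).
exists f, g => // x; apply/esym/eqP; rewrite -subr_eq0; apply/eqP.
exact: (congr1 val (ker0 (proj x))).
Qed.

End Retract.

(** * Ascending chains of ideals and units of local rings *)

Section Ideals.
Variable A : comNzRingType.
Implicit Types J : set A.

Lemma ideal0 J : is_ideal J -> J 0.
Proof. by move=> [/set_mem]. Qed.

Lemma idealMl J a b : is_ideal J -> J b -> J (a * b).
Proof.
move=> [J0 JD] Jb; rewrite -[a * b]addr0; apply: set_mem.
by apply: JD => //; exact: mem_set.
Qed.

Lemma idealD J a b : is_ideal J -> J a -> J b -> J (a + b).
Proof.
move=> [J0 JD] Ja Jb; rewrite -[a]mul1r; apply: set_mem.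
by apply: JD => //; exact: mem_set.
Qed.

Lemma ideal_sum (I : eqType) J (s : seq I) (a : I -> A) :
  is_ideal J -> (forall i, i \in s -> J (a i)) -> J (\sum_(i <- s) a i).
Proof.
move=> idJ; elim: s => [|i s IH] Ja; first by rewrite big_nil; exact: ideal0.
rewrite big_cons; apply: idealD => //; first by apply: Ja; rewrite mem_head.
by apply: IH => j sj; apply: Ja; rewrite inE sj orbT.
Qed.

(** The union of the chain is an ideal, and its finitely many generators all appear by some
    stage. *)
Lemma noetherian_acc (J : nat -> set A) :
  noetherian A -> (forall i, is_ideal (J i)) ->
  (forall i, J i `<=` J i.+1) ->
  exists n, forall i, (n <= i)%N -> J i = J n.
Proof.
move=> noeth idJ incJ.
have leJ i j : (i <= j)%N -> J i `<=` J j.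
  elim: j => [|j IH]; first by rewrite leqn0 => /eqP->.
  by rewrite leq_eqVlt ltnS => /predU1P[->//|/IH Jij x /Jij]; exact: incJ.
pose U := \bigcup_i J i.
have [|s Us] := noeth U.
  split; first by apply/mem_set; exists 0%N => //; exact: set_mem (idJ 0%N).1.
  move=> a x y /set_mem[i _ Jx] /set_mem[j _ Jy]; apply/mem_set.
  exists (maxn i j) => //; apply: set_mem; apply: (idJ _).2; apply: mem_set.
    by apply: leJ Jx; rewrite leq_maxl.
  by apply: leJ Jy; rewrite leq_maxr.
have /choice[k kP] (i : 'I_(size s)) : exists k, J k s`_i.
  have [k _ ?] : U s`_i; last by exists k.
  rewrite Us; exists (fun j => (j == i :> nat)%:R); rewrite (bigD1 i) //=.
  rewrite eqxx mul1r big1 ?addr0 // => j /negPf.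
  by rewrite -val_eqE /= => ->; rewrite mul0r.
exists (\max_i k i)%N => i le_ni; apply/seteqP; split; last exact: leJ.
move=> x Jx; have {le_ni} : U x by exists i.
rewrite {}Us => -[c ->].
apply: ideal_sum => // j _; apply: idealMl => //.
by apply: leJ (kP j); exact: leq_bigmax.
Qed.

(** By Zorn, a non-unit lies in a maximal ideal, and [n] is the only one. *)
Lemma local_ring_unit (n : set A) u :
  local_ring n -> ~ n u -> exists v, u * v = 1.
Proof.
move=> [_ uniq_n] nu; apply: contrapT => no_v.
(* The empty chain has empty union, which is not an ideal, so [P] constrains only nonempty sets. The
   maximal element is nonempty, since otherwise the principal ideal [uR] would exceed it. *)
pose P J := J !=set0 -> idealr_closed [in J] /\ J u.
have [F FP totF|I [PI maxI]] := @Zorn_bigcup A P.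
  move=> [x0 [X0 FX0 X0x0]].
  have FI X x : F X -> X x -> idealr_closed [in X] /\ X u.
    by move=> FX Xx; apply: FP => //; exists x.
  split; last by exists X0 => //; exact: (FI _ _ FX0 X0x0).2.
  split.
  - apply/mem_set; exists X0 => //; apply: set_mem.
    by have [[]] := FI _ _ FX0 X0x0.
  - apply/negP => /set_mem[X FX X1].
    by have [[_ /negP]] := FI _ _ FX X1; case; exact: mem_set.
  - move=> a x y /set_mem[X FX Xx] /set_mem[Y FY Yy]; apply/mem_set.
    have [XY|YX] := totF _ _ FX FY.
      exists Y => //; apply: set_mem; have [[_ _ +] _] := FI _ _ FY Yy.
      by apply; apply: mem_set => //; exact: XY.
    exists X => //; apply: set_mem; have [[_ _ +] _] := FI _ _ FX Xx.
    by apply; apply: mem_set => //; exact: YX.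
pose uR : set A := [set x | exists v, x = u * v].
have uRu : uR u by exists 1; rewrite mulr1.
have uRI : idealr_closed [in uR].
  split; first by apply/mem_set; exists 0; rewrite mulr0.
    by apply/negP => /set_mem[v v1]; apply: no_v; exists v.
  move=> a _ _ /set_mem[v ->] /set_mem[w ->]; apply/mem_set.
  by exists (a * v + w); rewrite mulrDr mulrCA.
have [x Ix] : I !=set0.
  apply/set0P/eqP => I0; apply: (maxI uR); last by [].
  by rewrite I0; split=> // /(_ _ uRu).
have [idI Iu] := PI (ex_intro _ x Ix).
apply: nu; rewrite -(uniq_n I) //; split=> // J idJ IJ.
apply: contrapT => JI; apply: (maxI J).
  by split=> // JI'; apply: JI; apply/seteqP.
by move=> _; split=> //; exact: IJ.
Qed.

End Ideals.

(** * Integral closure of ideals, read off in the fraction field *)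

Section IntegralClosureIdeals.
Variable R : idomainType.
Local Notation V := (int_closure R).
Local Notation frac := (@tofrac R).

Lemma frac_neq0 (z : R) : z != 0 -> frac z != 0.
Proof. by rewrite tofrac_eq0. Qed.

Lemma frac_inj : injective frac.
Proof. by move=> x y /eqP; rewrite tofrac_eq => /eqP. Qed.

Lemma integral_fracP u : u \in @integral_frac R <-> integralOver frac u.
Proof. by split=> /asboolP. Qed.

(* The ideal zV \cap R (for z != 0). *)
Definition vdiv (z : R) : {pred R^o} :=
  [pred y | `[< integralOver frac (frac y / frac z) >]].

Lemma vdivE z y : (y \in vdiv z) = (frac y / frac z \in @integral_frac R).
Proof. by apply/asboolP/asboolP. Qed.

Fact vdiv_submod z : submod_closed (vdiv z).
Proof.
split=> [|a x y]; rewrite !vdivE; first by rewrite tofrac0 mul0r; exact: rpred0.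
move=> xz yz; rewrite tofracD tofracM mulrDl -mulrA.
by apply: rpredD yz; apply: rpredM xz; exact: tofrac_integral.
Qed.

HB.instance Definition _ z :=
  GRing.isSubmodClosed.Build R R^o (vdiv z) (vdiv_submod z).

Lemma vdivP z y : z != 0 ->
  y \in vdiv z <-> exists u : V, frac y = frac z * val u.
Proof.
move=> /frac_neq0 z0; rewrite vdivE; split=> [yz|[u ->]].
  by exists (exist _ (frac y / frac z) yz); rewrite /= mulrC divfK.
by rewrite mulrC mulKf; [exact: valP|exact: z0].
Qed.

Lemma vdiv_refl z : z != 0 -> z \in vdiv z.
Proof. by move=> z0; apply/vdivP => //; exists 1; rewrite mulr1. Qed.

Lemma fracM_inj z (u v : V) :
  z != 0 -> frac z * val u = frac z * val v -> u = v.
Proof. by move=> /frac_neq0 z0 /(mulfI z0)/val_inj. Qed.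

(** Each factor from [I] contributes one [z], and a single cofactor in [J] puts the product in [J].
    The zeroth power is all of [R], hence the guard [0 < j]. *)
Lemma ideal_pow_frac (I : set R) (J : set V) (z : R) :
  is_ideal J ->
  (forall r, I r -> exists2 u, J u & frac r = frac z * val u) ->
  forall j a, ideal_pow I j a ->
  exists2 b : V, frac a = frac z ^+ j * val b & ((0 < j)%N -> J b).
Proof.
move=> idJ IJ; elim=> [a _|j IH _ [s [sI ->]]].
  by exists (to_int_closure a); rewrite ?expr0 ?mul1r.
elim: s sI => [|p s IHs] sI.
  exists 0; last by move=> _; exact: ideal0.
  by rewrite big_nil tofrac0 mulr0.
have [|b bE /(_ isT) Jb] := IHs.
  by move=> q sq; apply: sI; rewrite inE sq orbT.
have [/IJ[u Ju uE] /IH[c cE _]] := sI p (mem_head _ _).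
exists (c * u + b); last by move=> _; apply: idealD => //; exact: idealMl.
rewrite big_cons tofracD tofracM bE uE cE /= mulrDr exprS.
by congr (_ + _); rewrite mulrACA [val u * _]mulrC.
Qed.

(** Dividing the integral equation of [r] by [z ^+ n] gives a monic equation for r / z with lower
    coefficients in [J]. So r / z is integral over [R] and its n-th power lies in [J]. Both [J]
    maximal and [J] equal to V occur below. *)
Lemma ideal_closure_frac (I : set R) (J : set V) (z r : R) :
  z != 0 -> is_ideal J ->
  (forall x, I x -> exists2 u, J u & frac x = frac z * val u) ->
  ideal_closure I r ->
  exists2 u : V, frac r = frac z * val u & exists k, J (u ^+ k).
Proof.
move=> z0 idJ IJ [n [a [n0 aI rE]]]; have fz0 := frac_neq0 z0.
have /choice[b bP] i : exists b : V, (1 <= i <= n)%N ->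
    frac (a i) = frac z ^+ i * val b /\ J b.
  have [le_in|?] := boolP (1 <= i <= n)%N; last by exists 0.
  have [b bE Jb] := ideal_pow_frac idJ IJ (aI i le_in).
  by exists b => _; split=> //; apply: Jb; case/andP: le_in.
have [w rw] : exists w, frac r = w * frac z.
  by exists (frac r / frac z); rewrite divfK.
have wE : w ^+ n + \sum_(1 <= i < n.+1) val (b i) * w ^+ (n - i) = 0.
  apply: (mulfI (expf_neq0 n fz0)); rewrite mulr0 mulrDr -exprMn mulrC -rw.
  rewrite mulr_sumr -[RHS]tofrac0 -rE tofracD tofracXn rmorph_sum /=.
  congr (_ + _); apply: eq_big_nat => i le_in; have [aE _] := bP i le_in.
  have /andP[_ le_n] := le_in; rewrite ltnS in le_n.
  rewrite tofracM tofracXn aE rw exprMn -{1}(subnKC le_n) exprD.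
  by rewrite -!mulrA; congr (_ * _); rewrite mulrCA [X in _ * X]mulrC.
(* The lower-order terms: [w] is a root of the monic ['X^n + q], whose coefficients are integral
   over [R]. *)
pose q := \poly_(i < n) val (b (n - i)%N).
have qE : q.[w] = \sum_(1 <= i < n.+1) val (b i) * w ^+ (n - i).
  rewrite horner_poly big_add1 big_nat_rev big_mkord; apply: eq_bigr => i _.
  by rewrite add0n subnSK // subKn // ltnW.
have w_int : w \in @integral_frac R.
  apply/asboolP; apply: (@integral_root_monic _ _ _ w ('X^n + q)).
  - rewrite monicE lead_coefDl ?lead_coefXn // size_polyXn ltnS.
    exact: size_poly.
  - by apply/rootP; rewrite hornerD hornerXn qE.
  - apply/integral_poly => i; apply/integral_fracP.
    rewrite coefD coefXn coef_poly.
    apply: rpredD; first exact: rpred_nat.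
    by case: ifP => _; [exact: valP | exact: rpred0].
exists (exist _ w w_int); first by rewrite /= rw mulrC.
exists n; suff -> : (exist _ w w_int : V) ^+ n =
    - \sum_(1 <= i < n.+1) b i * (exist _ w w_int : V) ^+ (n - i).
  rewrite -mulN1r; apply: idealMl => //; apply: ideal_sum => // i.
  rewrite mem_index_iota => /bP[_ Jb]; rewrite mulrC; exact: idealMl.
apply/eqP; rewrite -addr_eq0; apply/eqP; apply: val_inj.
rewrite rmorphD rmorphXn rmorph_sum -[RHS]wE.
by congr (_ + _); apply: eq_bigr => i _; rewrite rmorphM rmorphXn.
Qed.

End IntegralClosureIdeals.

(** * Reflexive modules under the second Arf condition *)

Section ReflexiveModules.
Variable R : idomainType.
Local Notation V := (int_closure R).
Local Notation frac := (@tofrac R).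

(** The second Arf condition, with the division by [z] cleared. *)
Definition arf_mul : Prop := forall z x y : R, z != 0 ->
  x \in vdiv z -> y \in vdiv z -> exists r, z * r = x * y.

(** The isomorphism is multiplication by the fraction b / a. *)
Lemma scaled_submodule_iso (S T : submodClosed R^o) (a b : R) :
  a != 0 -> b != 0 ->
  (forall x : R, x \in S -> exists2 y : R, y \in T & a * y = b * x) ->
  (forall y : R, y \in T -> exists2 x : R, x \in S & b * x = a * y) ->
  mod_iso (submodule S) (submodule T).
Proof.
move=> a0 b0 ST TS.
have /choice[f fE] (x : submodule S) :
    exists y : submodule T, a * val y = b * val x.
  by have [y Ty yE] := ST _ (valP x); exists (exist _ y Ty).
have /choice[g gE] (y : submodule T) :
    exists x : submodule S, b * val x = a * val y.
  by have [x Sx xE] := TS _ (valP y); exists (exist _ x Sx).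
have f_lin : linear f.
  move=> c x y; apply: val_inj; apply: (mulfI a0); rewrite fE.
  rewrite -[LHS]/(b * (c * val x + val y)).
  rewrite -[RHS]/(a * (c * val (f x) + val (f y))).
  by rewrite !mulrDr mulrCA [in RHS]mulrCA !fE.
pose fL := GRing.isLinear.Build R _ _ _ f f_lin.
pose F : {linear submodule S -> submodule T} := HB.pack f fL.
exists F; exists g => [x|y]; apply: val_inj.
  by apply: (mulfI b0); rewrite gE fE.
by apply: (mulfI a0); rewrite fE gE.
Qed.

Section Module.
Variable M : lmodType R.
Implicit Types (x : M) (h : dual M).

Lemma dual_linear h : linear (val h).
Proof. exact/asboolP/(valP h). Qed.

Lemma dualP h a x y : val h (a *: x + y) = a * val h x + val h y.
Proof. exact: dual_linear. Qed.

Hypothesis reflM : reflexive_module M.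

Lemma reflexive_inj x y : (forall h, val h x = val h y) -> x = y.
Proof.
move=> xy; apply: (bij_inj reflM); apply: val_inj.
by apply/funext => h; exact: xy.
Qed.

Lemma reflexive_surj (phi : dual M -> R) :
  (forall a h k, phi (a *: h + k) = a * phi h + phi k) ->
  exists x, forall h, val h x = phi h.
Proof.
move=> phi_lin; have phiP : (phi : dual M -> R^o) \in @linear_fun R (dual M).
  by apply/asboolP.
pose Phi : dual (dual M) := exist _ (phi : dual M -> R^o) phiP.
have [ev _ evK] := reflM; exists (ev Phi) => h.
exact: (congr1 (fun F : dual (dual M) => val F h) (evK Phi)).
Qed.

(* With A = zV \cap R, the Arf condition says A^2 \subset zA, so A/z is a ring;
   the lemma makes it act on M, x' being (y/z) x. *)
Lemma reflexive_scale (z y : R) x :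
  arf_mul -> z != 0 -> (forall h x, val h x \in vdiv z) -> y \in vdiv z ->
  exists x', forall h, z * val h x' = y * val h x.
Proof.
move=> arf z0 Mz yz.
have /choice[phi phiE] h : exists r, z * r = y * val h x.
  exact: arf z0 yz (Mz h x).
have [|x' x'E] := @reflexive_surj phi; last by exists x' => h; rewrite x'E.
move=> a h k; apply: (mulfI z0); rewrite phiE !mulrDr mulrCA.
by rewrite [in RHS]mulrCA !phiE.
Qed.

(** The map w |-> (w / z) e is a section of [h], because [h] sends [e] to [z]; it is linear because
    functionals separate the points of [M]. *)
Lemma reflexive_retract (S : submodClosed R^o) (z : R) h e :
  indecomposable M -> z != 0 -> z \in S -> (forall x, val h x \in S) ->
  val h e = z ->
  (forall w : R, w \in S ->
     exists x, forall k : dual M, z * val k x = w * val k e) ->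
  mod_iso M (submodule S).
Proof.
move=> indecM z0 Sz Sh he Se.
have /choice[g gE] (w : submodule S) :
    exists x, forall k : dual M, z * val k x = val w * val k e.
  exact: Se (valP w).
have g_lin : linear g.
  move=> a w1 w2; apply: reflexive_inj => k; apply: (mulfI z0).
  rewrite gE dualP mulrDr mulrCA !gE.
  by rewrite -[val (_ + _)]/(a * val w1 + val w2) mulrDl mulrA.
pose gL := GRing.isLinear.Build R _ _ _ g g_lin.
pose G : {linear submodule S -> M} := HB.pack g gL.
pose f x : submodule S := exist _ (val h x) (Sh x).
have f_lin : linear f by move=> a x y; apply: val_inj; exact: dualP.
pose fL := GRing.isLinear.Build R _ _ _ f f_lin.
pose F : {linear M -> submodule S} := HB.pack f fL.
apply: (@indecomposable_retract _ _ _ F G indecM).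
  by move=> /(_ (exist _ z Sz))/(congr1 val)/eqP; apply/negP.
by move=> w; apply: val_inj; apply: (mulfI z0); rewrite gE he mulrC.
Qed.

(** Outside [n], [u] has an inverse [v]; rescaling [e] by [v] turns the value z u into [z] itself,
    and the retract argument applies. *)
Lemma reflexive_vdiv_iso (n : set V) (z : R) h e (u : V) :
  arf_mul -> local_ring n -> indecomposable M ->
  z != 0 -> (forall h x, val h x \in vdiv z) ->
  frac (val h e) = frac z * val u -> ~ n u ->
  mod_iso M (submodule (vdiv z)).
Proof.
move=> arf loc_n indecM z0 Mz uE nu.
have [v uv] := local_ring_unit loc_n nu.
have he0 : val h e != 0 :> R.
  rewrite -tofrac_eq0 uE mulf_neq0 ?frac_neq0 //; apply/eqP => u0.
  have u_eq0 : u = 0 by exact: val_inj.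
  by move: uv => /eqP; rewrite u_eq0 mul0r eq_sym oner_eq0.
have hev : frac (val h e) * val v = frac z.
  by rewrite uE -mulrA -rmorphM uv rmorph1 mulr1.
have z_he : z \in vdiv (val h e : R) by apply/(vdivP _ he0); exists v.
(* This [y] is z v, so that scaling by y / z is scaling by [v]. *)
have [y yE] := arf _ _ _ he0 z_he z_he.
have yz : y \in vdiv z.
  apply/(vdivP _ z0); exists v; apply: (mulfI (frac_neq0 he0)).
  by rewrite mulrCA hev -!tofracM yE.
have [e1 e1E] := reflexive_scale e arf z0 Mz yz.
have he1 : val h e1 = z by apply: (mulfI z0); rewrite e1E mulrC.
apply: (reflexive_retract indecM z0 (vdiv_refl z0) (Mz h) he1) => w.
exact: reflexive_scale.
Qed.

End Module.
End ReflexiveModules.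

(** * Denominators and the tower of ideals *)

Lemma fraction_repr (R : idomainType) (w : {fraction R}) :
  exists a b : R, b != 0 /\ tofrac a = tofrac b * w.
Proof.
elim/quotW: w => x; exists (frac x).1, (frac x).2.
have x2 := denom_ratioP x; split=> //.
rewrite !piE; apply/eqmodP; rewrite /= FracField.equivfE /FracField.mulf.
by rewrite !numden_Ratio ?oner_neq0 ?mul1r ?mulr1 // mulrC.
Qed.

Section Tower.
Variable R : idomainType.
Local Notation V := (int_closure R).
Local Notation frac := (@tofrac R).
Variable n : set V.
Implicit Types (x y z : R) (u v : V).

(** This is zn \cap R. *)
Definition strict_vdiv z : set R :=
  [set y | exists2 u : V, n u & frac y = frac z * val u].

Lemma arf_local_domain_mul (m : set R) : arf_local_domain m -> arf_mul R.
Proof.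
move=> [_ _ arf] z x y z0 /asboolP xz /asboolP yz.
have [r rE] := arf z x y (mulfI z0) xz yz; exists r; apply: frac_inj.
by rewrite tofracM rE mulrC divfK // frac_neq0.
Qed.

Lemma local_not1 : local_ring n -> ~ n 1.
Proof. by move=> [[[_ /negP n1 _] _] _] /mem_set. Qed.

Lemma local_is_ideal : local_ring n -> is_ideal n.
Proof. by move=> [[[? _ ?] _] _]. Qed.

Lemma local_expr u k : local_ring n -> n (u ^+ k) -> n u.
Proof.
move=> loc_n nuk; apply: contrapT => nu.
have [v uv] := local_ring_unit loc_n nu.
apply: (local_not1 loc_n); rewrite -(expr1n _ k) -uv exprMn mulrC.
exact: idealMl (local_is_ideal loc_n) nuk.
Qed.

(** A prime chain of length one supplies a nonzero [x] in a proper ideal; were [x] a unit of V, the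
    second Arf condition would put 1 / x in [R]. Multiples z x then provide the non-zerodivisors
    that the first Arf condition asks for. *)
Lemma strict_vdiv_nonzero : arf_mul R -> local_ring n -> krull_dim_eq R 1 ->
  exists2 x, x != 0 & strict_vdiv 1 x.
Proof.
move=> arf loc_n [[p [p_prime p_lt]] _].
have [[[p00 _ _] _] [[_ /negP p11 pD] _]] := (p_prime 0%N isT, p_prime 1%N isT).
have [_ /existsNP[x /not_implyP[px p0x]]] := p_lt 0%N isT.
have x0 : x != 0 by apply/eqP => x0; apply: p0x; rewrite x0; exact: set_mem.
exists x => //; exists (to_int_closure x); last by rewrite tofrac1 mul1r.
apply: contrapT => nx; have [v xv] := local_ring_unit loc_n nx.
have one_x : 1 \in vdiv x.
  apply/(vdivP _ x0); exists v.
  by rewrite tofrac1 -[LHS](rmorph1 (val : V -> _)) -xv rmorphM.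
have [y xy] := arf x 1 1 x0 one_x one_x.
apply: p11; rewrite -[1]mulr1 -xy mulrC -[_ * _]addr0; apply: pD.
  exact: mem_set.
apply: mem_set; have [[p10 _ _] _] := p_prime 1%N isT; exact: set_mem.
Qed.

(** An element of the integral closure is z u with a power of [u] in [n], which forces [u] into
    [n]. *)
Lemma strict_vdiv_closed z : local_ring n -> z != 0 ->
  integrally_closed_ideal (strict_vdiv z).
Proof.
move=> loc_n z0; have idn := local_is_ideal loc_n; split.
  split.
    apply/mem_set; exists 0; first exact: ideal0.
    by rewrite mulr0 tofrac0.
  move=> a x y /set_mem[u nu xE] /set_mem[v nv yE]; apply/mem_set.
  exists (to_int_closure a * u + v).
    by apply: idealD => //; exact: idealMl.
  rewrite tofracD tofracM xE yE rmorphD rmorphM mulrDr.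
  by congr (_ + _); exact: mulrCA.
apply/seteqP; split=> [y yz|y /(ideal_closure_frac z0 idn)].
  (* The degree-one equation y + (- y) = 0. *)
  exists 1%N, (fun=> - y); split=> // [i|]; last first.
    by rewrite big_nat1 subnn mulr1 subrr.
  case: i => [|[|i]] // _; exists [:: (- y, 1)]; split; last first.
    by rewrite big_seq1 mulr1.
  move=> p; rewrite mem_seq1 => /eqP-> /=; split=> //.
  have [u nu yE] := yz; exists (- u); last by rewrite tofracN yE rmorphN mulrN.
  by rewrite -mulN1r; exact: idealMl.
move=> /(_ _)[//|u yE [k nuk]]; exists u => //; exact: local_expr nuk.
Qed.

(** The first Arf condition makes zn \cap R the integral closure of some (a), and this closure lies
    in aV. *)
Lemma strict_vdiv_reduction (m : set R) z :
  arf_local_domain m -> local_ring n -> z != 0 -> exists z', [/\ z' != 0, strict_vdiv z z'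
    & forall y, strict_vdiv z y -> y \in vdiv z'].
Proof.
move=> arfR loc_n z0; have arf := arf_local_domain_mul arfR.
have [[_ _ _ dimR] red _] := arfR.
have [x x0 [u nu xE]] := strict_vdiv_nonzero arf loc_n dimR.
have zx0 : z * x != 0 by rewrite mulf_neq0.
have zxP : strict_vdiv z (z * x).
  by exists u => //; rewrite tofracM xE tofrac1 mul1r.
have [|a az aE] := red _ (strict_vdiv_closed loc_n z0).
  by exists (z * x) => //; exact: mulfI.
have a_frac y : gen_ideal [:: a] y ->
    exists2 v : V, setT v & frac y = frac a * val v.
  move=> [c ->]; exists (to_int_closure (c 0%N)) => //.
  by rewrite big_ord_recl big_ord0 addr0 tofracM mulrC.
have a0 : a != 0.
  (* Were [a] zero, the lower coefficients of the integral equation of z x would vanish, making z x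
     nilpotent. *)
  apply/eqP => a0; move: zxP; rewrite aE a0 => -[k [b [k0 bI]]].
  have b0 i : (1 <= i <= k)%N -> b i = 0.
    move=> /[dup]/andP[i0 _]/bI; case: i i0 => // i _ [s [sI ->]].
    apply: big1_seq => p /andP[_ /sI[[c ->] _]].
    by rewrite big_ord_recl big_ord0 addr0 mulr0 mul0r.
  rewrite big1_seq => [|i]; last first.
    by rewrite mem_index_iota => /b0->; rewrite mul0r.
  by rewrite addr0 => /eqP; rewrite expf_eq0 k0 (negPf zx0).
exists a; split=> // y; rewrite {1}aE => ya.
have [|v yE _] := ideal_closure_frac a0 (J := setT) _ a_frac ya.
  by split=> [|? ? ? _ _]; apply/mem_set.
by apply/(vdivP _ a0); exists v.
Qed.

(** The product of denominators of finitely many generators of V works. *)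
Lemma int_closure_denominator :
  finitely_generated (V : lmodType R) ->
  exists2 d, d != 0 & forall u, exists x, frac x = frac d * val u.
Proof.
move=> [k [g gP]].
have /choice[b bP] (i : 'I_k) :
    exists b, b != 0 /\ exists x, frac x = frac b * val (g i).
  have [x [b [b0 xE]]] := fraction_repr (val (g i)).
  by exists b; split=> //; exists x.
have /choice[a aE] (i : 'I_k) := (bP i).2.
exists (\prod_i b i) => [|u]; first by apply/prodf_neq0 => i _; exact: (bP i).1.
have [c ->] := gP u.
exists (\sum_i c i * (\prod_(j | j != i) b j) * a i).
rewrite !rmorph_sum mulr_sumr; apply: eq_bigr => i _.
rewrite -[RHS]/(frac (\prod_j b j) * (frac (c i) * val (g i))).
rewrite [in RHS](bigD1 i) //=.
rewrite -[LHS]/(frac (c i * (\prod_(j | j != i) b j) * a i)) !tofracM aE.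
by rewrite mulrACA [in RHS]mulrACA [frac (c i) * _]mulrC.
Qed.

(** Write x = z_i v_i and z_{i+1} = z_i w_i with w_i in [n]. For nonzero [x], a stable chain would
    give v_{k+1} = u w_k v_{k+1}, hence 1 = u w_k in [n]. *)
Lemma strict_tower_inter (d : R) (z : nat -> R) x :
  noetherian R -> local_ring n -> d != 0 ->
  (forall u, exists x, frac x = frac d * val u) ->
  (forall i, z i != 0) -> (forall i, strict_vdiv (z i) (z i.+1)) ->
  (forall i, x \in vdiv (z i)) -> x = 0.
Proof.
move=> noeth loc_n d0 dV z0 zS xz; apply: contrapT => /eqP x0.
have /choice[v vE] i : exists v, frac x = frac (z i) * val v by exact/vdivP.
have /choice[w wP] i : exists w, n w /\ frac (z i.+1) = frac (z i) * val w.
  by have [w] := zS i; exists w.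
have vw i : v i = w i * v i.+1.
  apply: (fracM_inj (z0 i)); rewrite -vE (vE i.+1) (wP i).2 rmorphM.
  exact/esym/mulrA.
(* d v_i V is an increasing sequence of ideals of R, since v_i = w_i v_{i+1}. *)
pose J i : set R := [set y | exists u : V, frac y = frac d * val (u * v i)].
have [|i|k Jk] := noetherian_acc (J := J) noeth.
- move=> i; split.
    by apply/mem_set; exists 0; rewrite mul0r mulr0 tofrac0.
  move=> a y1 y2 /set_mem[u1 E1] /set_mem[u2 E2]; apply/mem_set.
  exists (to_int_closure a * u1 + u2); rewrite tofracD tofracM E1 E2.
  rewrite mulrDl rmorphD mulrDr -mulrA (rmorphM _ (to_int_closure a)).
  by congr (_ + _); exact: mulrCA.
- by move=> y [u yE]; exists (u * w i); rewrite -mulrA -vw.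
have [y yE] := dV (v k.+1).
have [u] : J k y by rewrite -(Jk k.+1) //; exists 1; rewrite mul1r.
rewrite yE => /(fracM_inj d0); rewrite (vw k) mulrA => E.
have v0 : val (v k.+1) != 0.
  apply: contra_neq x0 => v0; apply: frac_inj.
  by rewrite (vE k.+1) v0 mulr0 tofrac0.
have : val (1 : V) = val (u * w k).
  by apply: (mulIf v0); rewrite -!rmorphM -E mul1r.
move=> /val_inj one; apply: (local_not1 loc_n); rewrite one.
exact: idealMl (local_is_ideal loc_n) (wP k).1.
Qed.

Lemma strict_tower_stable (d : R) (z : nat -> R) :
  arf_mul R -> noetherian R -> d != 0 ->
  (forall u, exists x, frac x = frac d * val u) ->
  (forall i, z i != 0) -> (forall i, z i.+1 \in vdiv (z i)) ->
  exists k, forall i, (k <= i)%N ->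
    mod_iso (submodule (vdiv (z i))) (submodule (vdiv (z k))).
Proof.
move=> arf noeth d0 dV z0 zS.
(* J i is d times the ring (z_i V \cap R) / z_i, which grows with i. *)
pose J i : set R := [set y | exists2 u : V, frac y = frac d * val u
  & exists x, frac x = frac (z i) * val u].
have [|i|k Jk] := noetherian_acc (J := J) noeth.
- move=> i; split.
    by apply/mem_set; exists 0; rewrite mulr0; [|exists 0]; rewrite tofrac0.
  move=> a y1 y2 /set_mem[u1 E1 [x1 F1]] /set_mem[u2 E2 [x2 F2]]; apply/mem_set.
  exists (to_int_closure a * u1 + u2).
    rewrite tofracD tofracM E1 E2 rmorphD mulrDr rmorphM.
    by congr (_ + _); exact: mulrCA.
  exists (a * x1 + x2); rewrite tofracD tofracM F1 F2 rmorphD mulrDr rmorphM.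
  by congr (_ + _); exact: mulrCA.
(* If x = z_i u is in [R], then z_{i+1} u = z_{i+1} x / z_i is in [R] by the Arf condition. *)
- move=> y [u yE [x xE]]; exists u => //.
  have xz : x \in vdiv (z i) by apply/vdivP => //; exists u.
  have [r rE] := arf _ _ _ (z0 i) (zS i) xz; exists r.
  apply: (mulfI (frac_neq0 (z0 i))); rewrite -tofracM rE tofracM xE.
  exact: mulrCA.
exists k => i ki.
(* Equal rings have the same cofactors [u], so z_a u in [R] gives z_b u in [R]. *)
have transfer a b x : J a = J b -> x \in vdiv (z a) ->
    exists2 y : R, y \in vdiv (z b) & z a * y = z b * x.
  move=> Jab /(vdivP _ (z0 a))[u xE]; have [y yE] := dV u.
  have [u' yE' [x' xE']] : J b y by rewrite -Jab; exists u => //; exists x.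
  have uu' : u' = u by apply: (fracM_inj d0); rewrite -yE.
  rewrite {}uu' in xE'; exists x'; first by apply/vdivP => //; exists u.
  by apply: frac_inj; rewrite !tofracM xE xE' mulrCA.
apply: scaled_submodule_iso (z0 i) (z0 k) _ _ => x.
  by apply: transfer; rewrite Jk.
by apply: transfer; rewrite Jk.
Qed.

Lemma reflexive_in_tower (d : R) (z : nat -> R) (M : lmodType R) :
  arf_mul R -> noetherian R -> local_ring n -> d != 0 ->
  (forall u, exists x, frac x = frac d * val u) ->
  z 0%N = 1 -> (forall i, z i != 0) ->
  (forall i, strict_vdiv (z i) (z i.+1)) ->
  (forall i y, strict_vdiv (z i) y -> y \in vdiv (z i.+1)) ->
  indecomposable M -> reflexive_module M ->
  exists i, mod_iso M (submodule (vdiv (z i))).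
Proof.
move=> arf noeth loc_n d0 dV z1 z0 zS z_red indecM reflM.
apply: contrapT => no_iso.
have Mz i : forall (h : dual M) (a : M), val h a \in vdiv (z i).
  (* At stage 0 the ideal is all of [R], since z_0 = 1. Later, a value z_i u with [u] outside [n]
     would give the excluded isomorphism. *)
  elim: i => [|i IH] h a.
    apply/vdivP => //; exists (to_int_closure (val h a : R)).
    by rewrite z1 tofrac1 mul1r.
  have /(vdivP _ (z0 i))[u uE] := IH h a.
  apply: z_red; exists u => //; apply: contrapT => nu; apply: no_iso.
  by exists i; exact: reflexive_vdiv_iso uE nu.
(* All functionals take values in every z_i V, so they vanish and [M] is zero. *)
apply: indecM.1 => a; apply: (reflexive_inj reflM) => h.
have h0 (b : M) : val h b = 0.
  exact: (strict_tower_inter noeth loc_n d0 dV z0 zS (fun i => Mz i h b)).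
by rewrite !h0.
Qed.

End Tower.

Theorem corollary3p7 (R : idomainType) (m : set R)
    (hR : arf_local_domain m)
    (hloc : exists n : set (int_closure R), local_ring n)
    (hfin : finitely_generated (int_closure R : lmodType R)) :
  exists (k : nat) (L : 'I_k -> lmodType R),
    (forall i, [/\ finitely_generated (L i), indecomposable (L i)
                 & reflexive_module (L i)]) /\
    (forall M : lmodType R,
       finitely_generated M -> indecomposable M -> reflexive_module M ->
       exists i, mod_iso M (L i)).
Proof.
have [n loc_n] := hloc; have arf := arf_local_domain_mul hR.
have [[noeth _ _ _] _ _] := hR.
have [d d0 dV] := int_closure_denominator hfin.
(* The value at 0 is a dummy; the iteration starts at 1 and never reaches 0. *)
have /choice[next nextP] (z : R) : exists z', z != 0 ->
    [/\ z' != 0, strict_vdiv n z z'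
      & forall y, strict_vdiv n z y -> y \in vdiv z'].
  have [->|/(strict_vdiv_reduction hR loc_n)[z' z'P]] := eqVneq z 0.
    by exists 0.
  by exists z'.
pose z i := iter i next 1.
have z0 i : z i != 0.
  by elim: i => [|i /nextP[]//]; exact: oner_neq0.
have zS i : strict_vdiv n (z i) (z i.+1) by have [] := nextP _ (z0 i).
have z_red i y : strict_vdiv n (z i) y -> y \in vdiv (z i.+1).
  by have [_ _] := nextP _ (z0 i); apply.
have zV i : z i.+1 \in vdiv (z i).
  by have [u _ uE] := zS i; apply/vdivP => //; exists u.
have [k kP] := strict_tower_stable arf noeth d0 dV z0 zV.
pose good (M : lmodType R) :=
  [/\ finitely_generated M, indecomposable M & reflexive_module M].
(* The candidates have indices 0 to [k]; those of larger index are isomorphic to the one at [k]. *)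
have [|l [L [Lgood LP]]] := @finite_representatives R k.+1
  (fun i => submodule (vdiv (z i)) : lmodType R) good.
  move=> M [_ indecM reflM].
  have [i Mi] := reflexive_in_tower arf noeth loc_n d0 dV (erefl _) z0 zS z_red
    indecM reflM.
  have [le_ik|lt_ki] := leqP i k.
    by exists (Ordinal (le_ik : (i < k.+1)%N)).
  by exists ord_max; apply: mod_iso_trans Mi (kP i (ltnW lt_ki)).
by exists l, L; split=> // M fgM indecM reflM; exact: LP.
Qed.
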